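(* Let $\mathbb{D}$ be a countable set, $(G,+)$ a commutative group, $V$ a set of data vectors $\mathbb{D}\to G$ and $\vec{x}\in V$. Then $\vec{x}$ is reversible in $V$ if and only if there exist $\vec{v}_1,\dots,\vec{v}_n\in V$ such that $-\mathrm{weight}(\vec{x})=\sum_{i=1}^n\mathrm{weight}(\vec{v}_i)$.
   Context: A data vector is a function $\vec{v}:\mathbb{D}\to G$ with finite support $\{\alpha\mid\vec{v}(\alpha)\neq0\}$; addition and negation are pointwise. $\vec{y}$ is a permutation sum of $V$ if $\vec{y}=\sum_{i=1}^n\vec{v_i}\circ\theta_i$ for some $n\in\mathbb{N}$, $\vec{v_i}\in V$ (repetitions allowed) and permutations $\theta_i$ of $\mathbb{D}$. A vector $\vec{x}$ is reversible in $V$ if both $\vec{x}$ and $-\vec{x}$ are permutation sums of $V$. $\mathrm{weight}(\vec{v})=\sum_{\alpha\in\mathbb{D}}\vec{v}(\alpha)$. *)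

(* Defs.v *)
From mathcomp Require Import all_boot all_algebra.
From mathcomp Require Import mathcomp_extra boolp classical_sets functions.
From mathcomp Require Import cardinality fsbigop.

Set Implicit Arguments.
Unset Strict Implicit.
Unset Printing Implicit Defensive.

Import GRing.Theory.
Local Open Scope ring_scope.
Local Open Scope classical_set_scope.

(* Sums, opposites and 0 on [D -> G] are the pointwise ones of the zmodType
   instance for function spaces in [mathcomp.classical.functions]. *)

Definition data_vector (D : countType) (G : zmodType) : set (D -> G) :=
  [set v | finite_set [set a | v a != 0]].

Definition permutation_sum (D : countType) (G : zmodType)
    (V : set (D -> G)) (y : D -> G) : Prop :=
  exists (n : nat) (v : 'I_n -> D -> G) (theta : 'I_n -> D -> D),
    [/\ forall i, V (v i),
        forall i, bijective (theta i) &
        y = \sum_(i < n) (v i \o theta i)].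

Definition reversible (D : countType) (G : zmodType)
    (V : set (D -> G)) (x : D -> G) : Prop :=
  permutation_sum V x /\ permutation_sum V (- x).

(* The big operator of [fsbigop] sums over the support of [v] when it is finite,
   and is 0 otherwise. *)
Definition weight (D : countType) (G : zmodType) (v : D -> G) : G :=
  \sum_(a \in [set: D]) v a.

(* Main.v *)
Require Import Defs.
From mathcomp Require Import all_boot all_algebra.
From mathcomp Require Import mathcomp_extra boolp classical_sets functions.
From mathcomp Require Import cardinality fsbigop.

(** Weight is additive and invariant under permutations of [D], which gives the
    forward direction.  Conversely, [w := x + v_1 + ... + v_n] has weight 0.  If
    [s] enumerates a finite set containing the support of [w], the sum of [w]
    over all [size s] rotations of [s] is constantly [weight w = 0] on [s], and
    vanishes outside [s].  The nontrivial rotations therefore write [- w] as a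
    permutation sum, and [- x = v_1 + ... + v_n + (- w)]. *)

Import GRing.Theory.
Local Open Scope ring_scope.
Local Open Scope classical_set_scope.

(** Listing [s] cyclically from [a] onwards gives a rotation of [s], so following [next s] for
    [size s] steps meets each entry once. *)
Lemma traject_next_perm {T : eqType} (s : seq T) (a : T) :
  uniq s -> a \in s -> perm_eq (traject (next s) a (size s)) s.
Proof.
move=> us sa; have [i t st] := rot_to sa.
(* The closed cycle through [a :: t] returns to [a]: [rcons t a] is the trajectory from [next s a],
   and dropping its last point leaves [t]. *)
have := cycle_next us; rewrite -(rot_cycle i) st /= => /fpathP[n tn].
suff -> : traject (next s) a (size s) = rot i s by rewrite perm_rot.
have sz : size s = (size t).+1 by rewrite -(size_rot i) st.
have nE : n = (size t).+1.
  by rewrite -(size_traject (next s) (next s a) n) -tn size_rcons.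
rewrite st sz trajectS; congr cons.
by move: tn; rewrite nE trajectSr => /rcons_inj[].
Qed.

Lemma bijective_next {T : eqType} (s : seq T) :
  uniq s -> bijective (next s).
Proof. by move=> us; exists (prev s); [exact: prev_next|exact: next_prev]. Qed.

Lemma bijective_iter {T : Type} (f : T -> T) (n : nat) :
  bijective f -> bijective (iter n f).
Proof.
by move=> bf; elim: n => [|n IH]; [exists id|exact: bij_comp bf IH].
Qed.

Section Weight.
Context {D : countType} {G : zmodType}.
Implicit Types (u v : D -> G) (V : set (D -> G)).

Lemma data_vectorP v : data_vector v <->
  exists2 s : seq D, uniq s & forall a, a \notin s -> v a = 0.
Proof.
split=> [/finite_seqP[s vs]|[s us vs]].
  exists (undup s); rewrite ?undup_uniq// => a; rewrite mem_undup => sa.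
  apply/eqP; apply: contraNT sa => va.
  by have : [set a | v a != 0] a by []; rewrite vs.
apply: (@sub_finite_set _ _ [set` s]); last by apply/finite_seqP; exists s.
by move=> a /= va; apply: contraNT va => /vs ->.
Qed.

Lemma weight_seqE v (s : seq D) : uniq s ->
  (forall a, a \notin s -> v a = 0) -> weight v = \sum_(a <- s) v a.
Proof.
move=> us vs; rewrite /weight (fsbigE s)//; last by move=> a _ /vs.
by apply: eq_bigl => a; rewrite in_setT.
Qed.

(** With one list for the whole family, all weights become sums over the same index and can be
    exchanged with the sum over [i]. *)
Lemma data_vectors_common_support n (v : 'I_n -> D -> G) :
  (forall i, data_vector (v i)) ->
  exists2 s : seq D, uniq s & forall i a, a \notin s -> v i a = 0.
Proof.
move=> /(_ _)/data_vectorP hv.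
have /choice[f fP] : forall i, exists s : seq D,
    forall a, a \notin s -> v i a = 0 by move=> i; have [s] := hv i; exists s.
exists (undup (flatten [seq f i | i <- enum 'I_n])); first exact: undup_uniq.
move=> i a; rewrite mem_undup => sa; apply: fP; apply: contra sa => fa.
by apply/flatten_mapP; exists i; rewrite ?mem_enum.
Qed.

Lemma data_vector_sum n (v : 'I_n -> D -> G) :
  (forall i, data_vector (v i)) -> data_vector (\sum_(i < n) v i).
Proof.
move=> /data_vectors_common_support[s us vs].
apply/data_vectorP; exists s => // a sa.
by rewrite fct_sumE big1// => i _; exact: vs.
Qed.

Lemma weight_sum n (v : 'I_n -> D -> G) : (forall i, data_vector (v i)) ->
  weight (\sum_(i < n) v i) = \sum_(i < n) weight (v i).
Proof.
move=> /data_vectors_common_support[s us vs].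
rewrite (@weight_seqE _ s)//; last first.
  by move=> a sa; rewrite fct_sumE big1// => i _; exact: vs.
under eq_bigr do rewrite fct_sumE.
rewrite exchange_big; apply: eq_bigr => i _.
by rewrite (@weight_seqE _ s)// => a /vs.
Qed.

Lemma data_vectorD u v :
  data_vector u -> data_vector v -> data_vector (u + v).
Proof.
move=> hu hv; pose f (i : 'I_2) := if i == 0 then u else v.
have -> : u + v = \sum_(i < 2) f i by rewrite big_ord_recl big_ord1.
by apply: data_vector_sum => i; rewrite /f; case: ifP.
Qed.

Lemma weightD u v : data_vector u -> data_vector v ->
  weight (u + v) = weight u + weight v.
Proof.
move=> hu hv; pose f (i : 'I_2) := if i == 0 then u else v.
have -> : u + v = \sum_(i < 2) f i by rewrite big_ord_recl big_ord1.
rewrite weight_sum; first by rewrite big_ord_recl big_ord1.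
by move=> i; rewrite /f; case: ifP.
Qed.

Lemma weight_comp v (theta : D -> D) : bijective theta ->
  weight (v \o theta) = weight v.
Proof. by move=> bt; rewrite /weight [RHS](reindex_fsbigT theta). Qed.

Lemma data_vector_comp v (theta : D -> D) : bijective theta ->
  data_vector v -> data_vector (v \o theta).
Proof.
move=> [eta thK etK] /data_vectorP[s us vs]; apply/data_vectorP.
(* Since [eta] inverts [theta], this list enumerates the preimage of [s] under [theta]. *)
exists (map eta s); first by rewrite (map_inj_uniq (can_inj etK)).
by move=> a sa; apply: vs; apply: contra sa => /(map_f eta); rewrite thK.
Qed.

Lemma permutation_sum_mem V v : V v -> permutation_sum V v.
Proof.
move=> Vv; exists 1, (fun=> v), (fun=> id); split=> //; first by exists id.
by rewrite big_ord1.
Qed.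

Lemma permutation_sum0 V : permutation_sum V 0.
Proof.
by exists 0, (fun=> 0), (fun=> id); split=> [[]//|[]//|]; rewrite big_ord0.
Qed.

Lemma permutation_sumD V u v :
  permutation_sum V u -> permutation_sum V v -> permutation_sum V (u + v).
Proof.
move=> [m [f [th [Vf bth ->]]]] [n [g [et [Vg bet ->]]]].
exists (m + n)%N,
  (fun i => match fintype.split i with inl j => f j | inr j => g j end),
  (fun i => match fintype.split i with inl j => th j | inr j => et j end).
split=> [i|i|]; [by case: fintype.split|by case: fintype.split|].
rewrite big_split_ord/=; congr (_ + _); apply: eq_bigr => i _.
  (* Seen as an [unsplit], the shifted index lets the [match] on [split] reduce. *)
  by rewrite -[lshift n i]/(unsplit (inl i)) unsplitK.
by rewrite -[rshift m i]/(unsplit (inr i)) unsplitK.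
Qed.

Lemma permutation_sum_sum V n (v : 'I_n -> D -> G) :
  (forall i, permutation_sum V (v i)) -> permutation_sum V (\sum_(i < n) v i).
Proof.
move=> hv; apply: (big_ind (permutation_sum V)) => //.
- exact: permutation_sum0.
- by move=> u w; exact: permutation_sumD.
Qed.

(** Precomposition distributes over pointwise sums, so [theta] is absorbed into each [th i]. *)
Lemma permutation_sum_comp V v (theta : D -> D) : bijective theta ->
  permutation_sum V v -> permutation_sum V (v \o theta).
Proof.
move=> bt [n [f [th [Vf bth ->]]]].
exists n, f, (fun i => th i \o theta); split=> // [i|]; first exact: bij_comp.
by apply/funext => a; rewrite /= !fct_sumE.
Qed.

Lemma sum_rotations_eq0 v (s : seq D) : uniq s ->
    (forall a, a \notin s -> v a = 0) -> weight v = 0 ->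
  \sum_(j < size s) (v \o iter j (next s)) = 0.
Proof.
move=> us vs v0; apply/funext => a; rewrite fct_sumE.
have [sa|sa] := boolP (a \in s); last first.
  rewrite big1// => j _ /=; apply: vs.
  (* [next s] preserves the complement of [s], where [v] vanishes. *)
  by elim: (nat_of_ord j) => //= k; rewrite mem_next.
transitivity (\sum_(b <- traject (next s) a (size s)) v b).
  rewrite (big_nth a) size_traject big_mkord.
  by apply: eq_bigr => j _; rewrite nth_traject.
by rewrite (perm_big _ (traject_next_perm s a us sa)) -weight_seqE.
Qed.

(** Membership in [V] would be too strong here: the lemma is applied to a sum of vectors of [V],
    which may lie outside [V]. *)
Lemma permutation_sumN V v : data_vector v -> weight v = 0 ->
  permutation_sum V v -> permutation_sum V (- v).
Proof.
move=> /data_vectorP[s us vs] v0 Vv.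
have := sum_rotations_eq0 v s us vs v0.
(* An empty [s] leaves no term [j = 0] to split off; then [v = 0]. *)
case sz: (size s) => [|k].
  have -> : v = 0 by apply/funext => a; apply: vs; rewrite (size0nil sz).
  by move=> _; rewrite oppr0; exact: permutation_sum0.
(* The term [j = 0] is [v] itself, so the other [k] rotations add up to [- v]. *)
rewrite big_ord_recl /= => /eqP; rewrite addrC addr_eq0 => /eqP <-.
apply: permutation_sum_sum => j; apply: permutation_sum_comp => //.
exact/bijective_iter/bijective_next.
Qed.

End Weight.

Theorem theorem11 (D : countType) (G : zmodType) (V : set (D -> G))
    (hV : V `<=` @data_vector D G) (x : D -> G) (hx : V x) :
  reversible V x <->
  exists (n : nat) (v : 'I_n -> D -> G),
    (forall i, V (v i)) /\ - weight x = \sum_(i < n) weight (v i).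
Proof.
split=> [[_ [n [v [th [Vv bth xE]]]]]|[n [v [Vv xE]]]].
  have hvt i : data_vector (v i \o th i) by apply: data_vector_comp; auto.
  exists n, v; split=> //; apply/eqP; rewrite eq_sym -addr_eq0; apply/eqP.
  (* Both sides come from the weight of [- x + x]: expanding [- x] as its permutation sum gives the
     left one, cancellation gives 0. *)
  transitivity (weight (- x + x)).
    rewrite xE weightD; [|exact: data_vector_sum|exact: hV].
    rewrite weight_sum//; congr (_ + _).
    by apply: eq_bigr => i _; rewrite weight_comp.
  by rewrite addNr (@weight_seqE _ _ _ [::])// big_nil.
have dv i : data_vector (v i) by exact: hV.
have psv : permutation_sum V (\sum_(i < n) v i).
  by apply: permutation_sum_sum => i; exact: permutation_sum_mem.
split; first exact: permutation_sum_mem.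
(* The parenthesised vector has weight 0 by [xE], so its opposite is a permutation sum. *)
have -> : - x = \sum_(i < n) v i + - (x + \sum_(i < n) v i).
  by rewrite opprD addrCA subrr addr0.
apply: permutation_sumD => //; apply: permutation_sumN.
- by apply: data_vectorD; [exact: hV|exact: data_vector_sum].
- rewrite weightD; [|exact: hV|exact: data_vector_sum].
  by rewrite weight_sum// -xE subrr.
- by apply: permutation_sumD => //; exact: permutation_sum_mem.
Qed.
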